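(* Let $\omega\in[0,1]$ and let $A\in\mathbb{C}^{m\times m}$, $B\in\mathbb{C}^{m\times n}$, $C\in\mathbb{C}^{n\times m}$, $D\in\mathbb{C}^{n\times n}$ be such that $XCX-XD-AX+B=0$ is in class $\mathbb{H}^\omega$, and suppose that $Q_\omega\mathbf{1}>0$, where $Q=\begin{pmatrix}D&-C\\-B&A\end{pmatrix}$. Let $\Phi$ and $\Psi$ be the extremal solutions of $XCX-XD-AX+B=0$ and of its dual $YBY-YA-DY+C=0$, respectively. Apply SDA to $XCX-XD-AX+B=0$ with $\alpha=tz_\omega^\bot$, where $z_\omega^\bot=\omega+\mathrm{j}(1-\omega)$. If $t\ge\max\{\psi_1,\psi_2\}$, where $$\psi_1=\max_{i=n+1,\dots,m+n}\frac{p_{\omega,i}}{\varpi},\qquad \psi_2=\max_{i=1,\dots,n}\frac{p_{\omega,i}}{\varpi},$$ then the sequences $\{E_k\},\{F_k\},\{H_k\},\{G_k\}$ are well-defined and $\{H_k\}$ and $\{G_k\}$ converge quadratically to $\Phi$ and $\Psi$, respectively.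
   Context: For a complex square matrix $M$ and a real $\omega\in[0,1]$, the $\omega$-comparison matrix $M_\omega$ is the real matrix with entries $[M_\omega]_{ii}=\omega\,\mathrm{Re}([M]_{ii})+(1-\omega)\,\mathrm{Im}([M]_{ii})$ and $[M_\omega]_{ij}=-|[M]_{ij}|$ for $i\ne j$. A real square matrix $M$ is a nonsingular M-matrix if all its off-diagonal entries are nonpositive and $Mu>0$ (entrywise) for some vector $u>0$. $\mathbf{1}$ is the all-ones column vector; $\mathrm{j}$ is the imaginary unit. The equation is in class $\mathbb{H}^\omega$ if $Q_\omega$ is a nonsingular M-matrix. Notation: $\varpi=\omega^2+(1-\omega)^2$, $q_i=\sum_{j\ne i}|[Q]_{ij}|$, and for $i=1,\dots,m+n$ $$p_{\omega,i}=\frac{\omega\mathrm{Re}([Q]_{ii})+(1-\omega)\mathrm{Im}([Q]_{ii})+q_i}{2}+\frac{(\omega\mathrm{Im}([Q]_{ii})-(1-\omega)\mathrm{Re}([Q]_{ii}))^2}{2(\omega\mathrm{Re}([Q]_{ii})+(1-\omega)\mathrm{Im}([Q]_{ii})-q_i)}.$$ Extremal solutions: $\Phi$ is the unique solution of $XCX-XD-AX+B=0$ such that every eigenvalue $\lambda$ of $D-C\Phi$ satisfies $\omega\,\mathrm{Re}(\lambda)+(1-\omega)\,\mathrm{Im}(\lambda)>0$; $\Psi$ is the unique solution of $YBY-YA-DY+C=0$ such that every eigenvalue $\lambda$ of $A-B\Psi$ satisfies the same inequality (both exist and are unique under these hypotheses). SDA with parameter $\alpha$ is the following algorithm with $\beta=\alpha$: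 put $A_\beta=A+\beta I$, $D_\alpha=D+\alpha I$, $W_{\alpha\beta}=A_\beta-BD_\alpha^{-1}C$, $V_{\alpha\beta}=D_\alpha-CA_\beta^{-1}B$, and $$E_0=I-(\alpha+\beta)V_{\alpha\beta}^{-1},\ F_0=I-(\alpha+\beta)W_{\alpha\beta}^{-1},\ G_0=(\alpha+\beta)D_\alpha^{-1}CW_{\alpha\beta}^{-1},\ H_0=(\alpha+\beta)W_{\alpha\beta}^{-1}BD_\alpha^{-1};$$ for $k\ge0$, $$E_{k+1}=E_k(I-G_kH_k)^{-1}E_k,\quad F_{k+1}=F_k(I-H_kG_k)^{-1}F_k,$$ $$G_{k+1}=G_k+E_k(I-G_kH_k)^{-1}G_kF_k,\quad H_{k+1}=H_k+F_k(I-H_kG_k)^{-1}H_kE_k.$$ ''Well-defined'' means all inverses involved exist. Quadratic convergence of the doubling algorithm means $\limsup_{k\to\infty}\|H_k-\Phi\|^{1/2^k}<1$ and $\limsup_{k\to\infty}\|G_k-\Psi\|^{1/2^k}<1$. *)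

(* Defs.v *)
From HB Require Import structures.
From mathcomp Require Import all_boot all_order all_algebra.
From mathcomp Require Import all_classical all_reals all_analysis.
From mathcomp Require Export complex.
Set Implicit Arguments.
Unset Strict Implicit.
Unset Printing Implicit Defensive.
Import Order.TTheory GRing.Theory Num.Theory.
Import numFieldNormedType.Exports.
Local Open Scope classical_set_scope.
Local Open Scope complex_scope.
Local Open Scope ring_scope.

Section Comparison.
Context {R : realType}.
Implicit Types (omega : R) (z : R[i]).

Definition omega_re omega z : R :=
  omega * complex.Re z + (1 - omega) * complex.Im z.

Definition omega_im omega z : R :=
  omega * complex.Im z - (1 - omega) * complex.Re z.

Definition omega_cmp N omega (M : 'M[R[i]]_N) : 'M[R]_N :=
  \matrix_(i, j) if i == j then omega_re omega (M i i)
                 else - Normc.normc (M i j).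

Definition pos_col N (v : 'cV[R]_N) : Prop := forall i, 0 < v i 0.

Definition nonsingular_Mmatrix N (M : 'M[R]_N) : Prop :=
  (forall i j, i != j -> M i j <= 0) /\
  exists2 u : 'cV[R]_N, pos_col u & pos_col (M *m u).

Definition offdiag_sum N (Q : 'M[R[i]]_N) (i : 'I_N) : R :=
  \sum_(j < N | j != i) Normc.normc (Q i j).

Definition varpi omega : R := omega ^+ 2 + (1 - omega) ^+ 2.

Definition p_omega N omega (Q : 'M[R[i]]_N) (i : 'I_N) : R :=
  (omega_re omega (Q i i) + offdiag_sum Q i) / 2 +
  omega_im omega (Q i i) ^+ 2 /
    (2 * (omega_re omega (Q i i) - offdiag_sum Q i)).

(* The supremum of a finite family is its maximum when the family is nonempty,
   that is, when 0 < N; it is the junk value 0 when N = 0. *)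
Definition max_ord N (f : 'I_N -> R) : R := sup (range f).

End Comparison.

Section Riccati.
Context {R : realType}.
Variables (m n : nat).

Definition are_coef (A : 'M[R[i]]_m) (B : 'M[R[i]]_(m, n))
    (C : 'M[R[i]]_(n, m)) (D : 'M[R[i]]_n) : 'M[R[i]]_(n + m) :=
  block_mx D (- C) (- B) A.

Definition class_H (omega : R) (A : 'M[R[i]]_m) (B : 'M[R[i]]_(m, n))
    (C : 'M[R[i]]_(n, m)) (D : 'M[R[i]]_n) : Prop :=
  nonsingular_Mmatrix (omega_cmp omega (are_coef A B C D)).

Definition are_solution (A : 'M[R[i]]_m) (B : 'M[R[i]]_(m, n))
    (C : 'M[R[i]]_(n, m)) (D : 'M[R[i]]_n) (X : 'M[R[i]]_(m, n)) : Prop :=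
  X *m C *m X - X *m D - A *m X + B = 0.

(* The dual equation YBY - YA - DY + C = 0 is obtained by exchanging A with D
   and B with C, so the extremal solution of the dual equation is
   [extremal_solution omega D C B A Psi]. *)
Definition extremal_solution (omega : R) (A : 'M[R[i]]_m)
    (B : 'M[R[i]]_(m, n)) (C : 'M[R[i]]_(n, m)) (D : 'M[R[i]]_n)
    (X : 'M[R[i]]_(m, n)) : Prop :=
  are_solution A B C D X /\
  forall lambda : R[i],
    eigenvalue (D - C *m X) lambda -> 0 < omega_re omega lambda.

End Riccati.

Section Doubling.
Context {R : realType}.
Variables (m n : nat).

Record doubling_state := DoublingState {
  dblE : 'M[R[i]]_n;
  dblF : 'M[R[i]]_m;
  dblG : 'M[R[i]]_(n, m);
  dblH : 'M[R[i]]_(m, n) }.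

Section Init.
Variables (A : 'M[R[i]]_m) (B : 'M[R[i]]_(m, n)).
Variables (C : 'M[R[i]]_(n, m)) (D : 'M[R[i]]_n).
Variables (alpha beta : R[i]).

Definition shiftA : 'M[R[i]]_m := A + beta%:M.
Definition shiftD : 'M[R[i]]_n := D + alpha%:M.
Definition matW : 'M[R[i]]_m := shiftA - B *m invmx shiftD *m C.
Definition matV : 'M[R[i]]_n := shiftD - C *m invmx shiftA *m B.

Definition doubling_init : doubling_state := DoublingState
  (1%:M - (alpha + beta) *: invmx matV)
  (1%:M - (alpha + beta) *: invmx matW)
  ((alpha + beta) *: (invmx shiftD *m C *m invmx matW))
  ((alpha + beta) *: (invmx matW *m B *m invmx shiftD)).

Definition doubling_step (s : doubling_state) : doubling_state :=
  let: DoublingState E F G H := s in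
  let IGH := invmx (1%:M - G *m H) in
  let IHG := invmx (1%:M - H *m G) in
  DoublingState (E *m IGH *m E) (F *m IHG *m F)
    (G + E *m IGH *m G *m F) (H + F *m IHG *m H *m E).

Definition doubling (k : nat) : doubling_state :=
  iter k doubling_step doubling_init.

(* [invmx M] is M itself when M is singular, so the iterates above are total;
   they are the genuine ones exactly when the following holds. *)
Definition doubling_well_defined : Prop :=
  [/\ shiftA \in unitmx, shiftD \in unitmx, matW \in unitmx, matV \in unitmx
    & forall k, let s := doubling k in
        (1%:M - dblG s *m dblH s \in unitmx) /\
        (1%:M - dblH s *m dblG s \in unitmx)].

End Init.

Definition SDA A B C D (alpha : R[i]) : nat -> doubling_state :=
  doubling A B C D alpha alpha.

Definition SDA_well_defined A B C D (alpha : R[i]) : Prop :=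
  doubling_well_defined A B C D alpha alpha.

End Doubling.

Section Convergence.
Context {R : realType}.

(* Largest modulus of an entry. Any other norm gives the same notion of
   quadratic convergence, since c ^ (1 / 2 ^ k) tends to 1 for every c > 0. *)
Definition cmx_norm p q (M : 'M[R[i]]_(p, q)) : R :=
  mx_norm (map_mx (@Normc.normc R) M).

Definition quadratically_converges p q (X : nat -> 'M[R[i]]_(p, q))
    (L : 'M[R[i]]_(p, q)) : Prop :=
  (limn_esup (fun k => (cmx_norm (X k - L) `^ ((2 ^+ k)^-1))%:E) < 1%:E)%E.

End Convergence.

(* Main.v *)
Require Import Defs.
From mathcomp Require Import all_boot all_order all_algebra.
From mathcomp Require Import all_classical all_reals all_analysis.
From mathcomp Require Import ring lra.
Set Implicit Arguments.
Unset Strict Implicit.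
Unset Printing Implicit Defensive.
Import Order.TTheory GRing.Theory Num.Theory.
Import numFieldNormedType.Exports.
Local Open Scope complex_scope.
Local Open Scope ring_scope.

(** Let [Q] be the matrix of coefficients and [al] the parameter of the
    algorithm.

    The condition on [t] implies, row by row, that
    [|Q i i - al| + q_i < |Q i i + al| - q_i], where [q_i] is the absolute sum
    of the off-diagonal entries ([omega_disk_dominance]).  Hence [Q + al] is
    invertible and the Cayley transform [T = (Q + al)^-1 (Q - al)] is a strict
    contraction for the supremum norm ([cayley_dominant_contraction]).  Up to
    the signs of its off-diagonal blocks, [T] is the initial state of the
    algorithm ([cayley_block_inverse]), so that
    [(a, b) |-> (E a + G b, H a + F b)] is a strict contraction.

    A doubling step is the star product of this block operator with itself:
    two copies of a scattering network are connected in series.  A series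
    connection of strict contractions is again one
    ([strict_contraction_step]).  This single invariant makes [1 - G H] and
    [1 - H G] invertible at every step and bounds all the [F].

    The extremal solution enters through the pair of equations
    [S = E + G Phi S] and [Phi = H + F Phi S], where [S] is the Cayley
    transform of [D - C Phi].  They hold for the initial state by the Riccati
    equation ([cayley_transfers]), and a doubling step preserves them with
    [S ^ 2] in place of [S] ([transfers_step]).  After [k] steps
    [Phi - H = F Phi S ^ (2 ^ k)].  The eigenvalues of [D - C Phi] lie in a
    half-plane whose points are closer to [al] than to [- al]
    ([halfplane_closer]), so those of [S] lie in the open unit disk and the
    powers of [S] decay geometrically ([contractive_powers]).  Therefore the
    error is at most [c r ^ (2 ^ k)] with [r < 1].

    The statement about [G] and [Psi] is the one about [H] for the dual
    equation, because exchanging the roles of the two blocks of indices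
    commutes with the doubling step. *)

Local Notation nrm := Normc.normc.

(** * Supremum norm of complex matrices *)
Section SupNorm.
Context {R : realType}.

Lemma normc_ge0 (x : R[i]) : 0 <= nrm x.
Proof. by case: x => a b; exact: sqrtr_ge0. Qed.

Lemma ler_normc_sum (I : finType) (P : pred I) (F : I -> R[i]) :
  nrm (\sum_(i | P i) F i) <= \sum_(i | P i) nrm (F i).
Proof.
elim/big_ind2: _ => [|x x' y y' xy xy'|//]; first by rewrite Normc.normc0.
by apply: le_trans (le_normcD _ _) _; rewrite lerD.
Qed.

Lemma cmx_norm_leP p q (M : 'M[R[i]]_(p, q)) c : 0 <= c ->
  reflect (forall i j, nrm (M i j) <= c) (cmx_norm M <= c).
Proof.
move=> c0; rewrite /cmx_norm mx_normrE; apply: (iffP (bigmax_leP _ _ _ _)).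
  by move=> [_ h] i j; have := h (i, j) isT; rewrite mxE ger0_norm// normc_ge0.
by move=> h; split=> // -[i j] _; rewrite mxE ger0_norm ?normc_ge0//=.
Qed.

Lemma cmx_norm_ltP p q (M : 'M[R[i]]_(p, q)) c : 0 < c ->
  reflect (forall i j, nrm (M i j) < c) (cmx_norm M < c).
Proof.
move=> c0; rewrite /cmx_norm mx_normrE; apply: (iffP (bigmax_ltP _ _ _ _)).
  by move=> [_ h] i j; have := h (i, j) isT; rewrite mxE ger0_norm// normc_ge0.
by move=> h; split=> // -[i j] _; rewrite mxE ger0_norm ?normc_ge0//=.
Qed.

Lemma cmx_norm_ge0 p q (M : 'M[R[i]]_(p, q)) : 0 <= cmx_norm M.
Proof. by rewrite /cmx_norm mx_normE. Qed.

Lemma normc_le_cmx p q (M : 'M[R[i]]_(p, q)) i j : nrm (M i j) <= cmx_norm M.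
Proof. by move: i j; apply/cmx_norm_leP => //; exact: cmx_norm_ge0. Qed.

Lemma cmx_norm_eq0 p q (M : 'M[R[i]]_(p, q)) : cmx_norm M <= 0 -> M = 0.
Proof.
move=> /cmx_norm_leP h; apply/matrixP => i j; rewrite mxE.
by apply: Normc.eq0_normc; apply/eqP; rewrite eq_le normc_ge0 h.
Qed.

Lemma cmx_normD p q (M N : 'M[R[i]]_(p, q)) :
  cmx_norm (M + N) <= cmx_norm M + cmx_norm N.
Proof.
apply/cmx_norm_leP => [|i j]; first by rewrite addr_ge0 ?cmx_norm_ge0.
by rewrite mxE (le_trans (le_normcD _ _))// lerD ?normc_le_cmx.
Qed.

Lemma cmx_normZ p q a (M : 'M[R[i]]_(p, q)) :
  cmx_norm (a *: M) <= nrm a * cmx_norm M.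
Proof.
apply/cmx_norm_leP => [|i j]; first by rewrite mulr_ge0 ?cmx_norm_ge0 ?normc_ge0.
by rewrite mxE Normc.normcM ler_wpM2l ?normc_ge0 ?normc_le_cmx.
Qed.

Lemma cmx_normN p q (M : 'M[R[i]]_(p, q)) : cmx_norm (- M) = cmx_norm M.
Proof.
suff leN (N : 'M[R[i]]_(p, q)) : cmx_norm (- N) <= cmx_norm N.
  by apply/le_anti; rewrite leN -{1}[M]opprK leN.
apply/cmx_norm_leP => [|i j]; first exact: cmx_norm_ge0.
by rewrite mxE normcN normc_le_cmx.
Qed.

Lemma cmx_normM p q r (M : 'M[R[i]]_(p, q)) (N : 'M[R[i]]_(q, r)) :
  cmx_norm (M *m N) <= q%:R * cmx_norm M * cmx_norm N.
Proof.
apply/cmx_norm_leP => [|i j]; first by rewrite !mulr_ge0 ?cmx_norm_ge0 ?ler0n.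
rewrite mxE; apply: le_trans (ler_normc_sum _ _) _.
have -> : q%:R * cmx_norm M * cmx_norm N = \sum_(k < q) (cmx_norm M * cmx_norm N).
  by rewrite sumr_const card_ord -mulrA mulr_natl.
apply: ler_sum => k _; rewrite Normc.normcM.
by rewrite ler_pM ?normc_ge0 ?normc_le_cmx.
Qed.

Lemma unitmx_of_ker p (M : 'M[R[i]]_p) :
  (forall v : 'cV_p, M *m v = 0 -> v = 0) -> M \in unitmx.
Proof.
move=> kerM; rewrite -unitmx_tr unitmxE unitfE.
apply/det0P => -[v v0 vM]; case/eqP: v0.
by rewrite -[v]trmxK (kerM v^T) ?trmx0// -[M]trmxK -trmx_mul vM trmx0.
Qed.

End SupNorm.

(** * Geometric decay of matrix powers *)
Section Powers.
Context {R : realType}.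

Lemma uniform_radius (s : seq R[i]) : {in s, forall l, nrm l < 1} ->
  exists2 r : R, 0 < r < 1 & {in s, forall l, nrm l < r}.
Proof.
elim: s => [_|l s IHs h].
  by exists 2^-1; [apply/andP; split; lra | move=> l; rewrite in_nil].
have [|r /andP[r0 r1] hr] := IHs.
  by move=> x xs; apply: h; rewrite inE xs orbT.
have l1 : nrm l < 1 by apply: h; rewrite mem_head.
exists (Num.max r ((nrm l + 1) / 2)).
  by rewrite lt_max r0 gt_max r1 /=; lra.
move=> x; rewrite inE => /orP[/eqP ->|/hr xr]; last by rewrite lt_max xr.
by rewrite lt_max; apply/orP; right; lra.
Qed.

(** This replaces a Schur or Jordan form: the linear factors of an
    annihilating polynomial are removed one at a time.  With
    [W = (M - l) V], the recurrence
    [M ^ (k + 1) V = M ^ k W + l (M ^ k V)] turns a bound for [W] into one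
    for [V], at the same rate since [|l| < r]. *)
Lemma annihilated_powers n (M : 'M[R[i]]_n.+1) (r : R)
    (s : seq R[i]) (V : 'M[R[i]]_n.+1) :
  0 < r -> {in s, forall l, nrm l < r} ->
  horner_mx M (\prod_(l <- s) ('X - l%:P)) * V = 0 ->
  exists2 c : R, 0 <= c & forall k, cmx_norm (M ^+ k * V) <= c * r ^+ k.
Proof.
move=> r0; elim: s V => [|l s IHs] V hs.
  rewrite big_nil rmorph1 mul1r => ->; exists 0 => // k.
  by rewrite mulr0 mul0r; apply/cmx_norm_leP => // i j; rewrite mxE Normc.normc0.
rewrite big_cons mulrC rmorphM /= rmorphB /= horner_mx_X horner_mx_C -mulrA.
move=> /IHs[|c c0 hc]; first by move=> x xs; apply: hs; rewrite inE xs orbT.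
have lr : 0 < r - nrm l by rewrite subr_gt0 hs ?mem_head.
(* [c / (r - |l|)] is the fixed point of the recurrence for the rescaled norms;
   [cmx_norm V] takes care of [k = 0]. *)
exists (cmx_norm V + c / (r - nrm l)).
  by rewrite addr_ge0 ?cmx_norm_ge0 ?divr_ge0// ltW.
elim=> [|k IHk].
  by rewrite !expr0 mul1r mulr1 lerDl divr_ge0// ltW.
have -> : M ^+ k.+1 * V = M ^+ k * ((M - l%:M) * V) + l *: (M ^+ k * V).
  rewrite exprSr mulrBl mulrBr !mulrA -!mulmxE mul_mx_scalar -scalemxAl.
  by rewrite subrK.
apply: le_trans (cmx_normD _ _) _.
apply: le_trans (lerD (hc k) (cmx_normZ _ _)) _.
apply: le_trans (lerD (lexx _) (ler_wpM2l (normc_ge0 _) IHk)) _.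
rewrite exprS !mulrA -mulrDl ler_wpM2r ?exprn_ge0 ?(ltW r0)//.
set K := cmx_norm V; set e := c / _.
have -> : c = e * (r - nrm l) by rewrite divfK// gt_eqF.
have : 0 <= K * (r - nrm l) by rewrite mulr_ge0 ?cmx_norm_ge0// ltW.
lra.
Qed.

(** By Cayley-Hamilton the characteristic polynomial annihilates [M], and its
    roots are the eigenvalues. *)
Lemma contractive_powers n (M : 'M[R[i]]_n) :
  (forall l, eigenvalue M l -> nrm l < 1) ->
  exists2 r : R, 0 < r < 1 &
  exists2 c : R, 0 <= c & forall k, cmx_norm (M ^+ k) <= c * r ^+ k.
Proof.
case: n M => [|n] M hM.
  exists 2^-1; first by apply/andP; split; lra.
  exists 0 => // k; rewrite mul0r.
  by apply/cmx_norm_leP => // -[].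
have [s sE] := closed_field_poly_normal (char_poly M).
move: sE; rewrite (monicP (char_poly_monic M)) scale1r => sE.
have [|r /andP[r0 r1] hr] := @uniform_radius s.
  by move=> l ls; apply: hM; rewrite eigenvalue_root_char sE root_prod_XsubC.
exists r; first by rewrite r0.
have [|c c0 hc] := @annihilated_powers n M r s 1 r0 hr.
  by rewrite -sE Cayley_Hamilton mul0r.
by exists c => // k; rewrite -[_ ^+ k]mulr1.
Qed.

(** The constant [c] is absorbed by enlarging the rate from [r] to any
    [s < 1], because [c (r / s) ^ k] tends to [0]. *)
Lemma geometric_quadratically_converges p q (X : nat -> 'M[R[i]]_(p, q)) L
    (c r : R) :
  0 <= c -> 0 < r < 1 -> (forall k, cmx_norm (X k - L) <= c * r ^+ (2 ^ k)) ->
  quadratically_converges X L.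
Proof.
move=> c0 /andP[r0 r1] hX.
have [s rs s1] : exists2 s, r < s & s < 1 by exists ((r + 1) / 2); lra.
have s0 : 0 < s := lt_trans r0 rs.
have [k0 hk0] : exists k0, forall k, (k0 <= k)%N -> c * (r / s) ^+ k <= 1.
  have : ((c * (r / s) ^+ k)%R @[k --> \oo] --> (0 : R))%classic.
    rewrite -(mulr0 c); apply: cvgMr.
    apply: cvg_expr; rewrite ger0_norm ?divr_ge0 ?(ltW r0) ?(ltW s0)//.
    by rewrite ltr_pdivrMr ?mul1r.
  move=> /cvgr_le /(_ 1 ltr01)[k0 _ hk0].
  by exists k0 => k hk; apply: hk0.
rewrite /quadratically_converges; apply: (@le_lt_trans _ _ s%:E);
  last by rewrite lte_fin.
rewrite /limn_esup /limf_esup.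
apply: ge_ereal_inf.
eexists.
  exists [set k | (k0 <= k)%N]%classic; last reflexivity.
  by exists k0.
apply: ge_ereal_sup => _ [k /= k0k <-]; rewrite lee_fin.
have hs : cmx_norm (X k - L) <= s ^+ (2 ^ k).
  apply: le_trans (hX k) _.
  have -> : c * r ^+ (2 ^ k) = c * (r / s) ^+ (2 ^ k) * s ^+ (2 ^ k).
    by rewrite -mulrA -exprMn divfK// gt_eqF.
  rewrite -[leRHS]mul1r ler_wpM2r ?exprn_ge0 ?(ltW s0)// hk0//.
  by rewrite (leq_trans k0k)// ltnW// ltn_expl.
apply: le_trans (ge0_ler_powR _ _ _ hs) _.
- by rewrite invr_ge0 exprn_ge0.
- by rewrite nnegrE cmx_norm_ge0.
- by rewrite nnegrE exprn_ge0// ltW.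
rewrite -powR_mulrn ?(ltW s0)// -powRrM natrX mulfV ?expf_neq0// powRr1//.
exact: ltW.
Qed.

End Powers.

(** * Two invariants of the doubling step *)

Section TransferAlgebra.
Context {K : comUnitRingType} (m n : nat).
Variables (E : 'M[K]_n) (F : 'M[K]_m) (G : 'M[K]_(n, m)) (H : 'M[K]_(m, n)).
Variables (X : 'M[K]_(m, n)) (S : 'M[K]_n).
Hypotheses (SE : S = E + G *m X *m S) (XE : X = H + F *m X *m S).

Lemma transfer_mulF : F *m X *m S *m S = X *m S - H *m S.
Proof. by rewrite {2}XE mulmxDl addrC addKr. Qed.

(** In the scattering picture of [strict_contraction], a wave [x] entering a
    network that is terminated by [X] comes out as [S x] and is reflected as
    [X x].  Cascading two copies of the network gives [S ^ 2] and leaves the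
    reflection [X] unchanged. *)
Lemma transfer_factor_step (I : 'M[K]_n) : I *m (1%:M - G *m H) = 1%:M ->
  S *m S = E *m I *m E + (G + E *m I *m G *m F) *m X *m (S *m S).
Proof.
move=> IGH; have eqS : E + G *m F *m X *m S *m S = (1%:M - G *m H) *m S.
  rewrite -!(mulmxA G) transfer_mulF mulmxBl mul1mx mulmxBr {3}SE !mulmxA.
  by rewrite addrA.
rewrite {1}SE mulmxDl -[X in E *m X](mul1mx S) -IGH -mulmxA -eqS.
rewrite !mulmxDr !mulmxDl !mulmxA -addrA.
by congr (_ + _); rewrite addrC.
Qed.

Lemma transfer_limit_step (I : 'M[K]_m) : I *m (1%:M - H *m G) = 1%:M ->
  X = H + F *m I *m H *m E + F *m I *m F *m X *m (S *m S).
Proof.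
move=> IHG.
have eqX : H *m E + F *m X *m S *m S = (1%:M - H *m G) *m (X *m S).
  have HS : H *m S = H *m E + H *m G *m X *m S by rewrite {1}SE mulmxDr !mulmxA.
  by rewrite transfer_mulF mulmxBl mul1mx HS opprD addrCA addNKr !mulmxA.
rewrite {1}XE -mulmxA -[X *m S]mul1mx -IHG -(mulmxA I) -eqX.
by rewrite !mulmxDr !mulmxA addrA.
Qed.

End TransferAlgebra.

Section DoublingStep.
Context {R : realType}.

(** Exchanging the two ends of the network: this turns the equation into its
    dual, so every fact about [G] is the fact about [H] for the swapped
    state. *)
Definition swap_state m n (s : @doubling_state R m n) : @doubling_state R n m :=
  DoublingState (dblF s) (dblE s) (dblH s) (dblG s).

Lemma swap_doubling_step m n (s : @doubling_state R m n) :
  swap_state (doubling_step s) = doubling_step (swap_state s).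
Proof. by case: s. Qed.

(** A state is read as a scattering network: the waves [a] and [b] that enter
    at its two ends leave as [E a + G b] and [H a + F b].  The operator
    norm of this map for the supremum norm is less than [1]; its value is left
    out because strictness alone is preserved by the doubling step. *)
Definition strict_contraction m n (s : @doubling_state R m n) : Prop :=
  forall (a : 'cV[R[i]]_n) (b : 'cV[R[i]]_m) (c : R),
    0 < c -> cmx_norm a <= c -> cmx_norm b <= c ->
    cmx_norm (dblE s *m a + dblG s *m b) < c /\
    cmx_norm (dblH s *m a + dblF s *m b) < c.

Lemma swap_strict_contraction m n (s : @doubling_state R m n) :
  strict_contraction s -> strict_contraction (swap_state s).
Proof.
move=> hs a b c c0 ac bc; have [h1 h2] := hs b a c c0 bc ac.
by rewrite /= addrC h2 addrC h1.
Qed.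

(** If [v = G (H v)] with [v <> 0], then two strict contractions would
    preserve the norm of [v]. *)
Lemma strict_contraction_unit m n (s : @doubling_state R m n) :
  strict_contraction s -> 1%:M - dblG s *m dblH s \in unitmx.
Proof.
move=> hs; apply: unitmx_of_ker => v; rewrite mulmxBl mul1mx => /eqP.
rewrite subr_eq0 => /eqP vE; apply: cmx_norm_eq0; rewrite leNgt; apply/negP => v0.
have z0 p : cmx_norm (0 : 'cV[R[i]]_p) <= cmx_norm v.
  by apply/cmx_norm_leP => [|i j]; rewrite ?(ltW v0)// mxE Normc.normc0 ltW.
have [_] := hs v 0 _ v0 (lexx _) (z0 _); rewrite mulmx0 addr0 => Hv.
have [+ _] := hs 0 (dblH s *m v) _ v0 (z0 _) (ltW Hv).
by rewrite mulmx0 add0r mulmxA -vE ltxx.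
Qed.

Lemma strict_contraction_F m n (s : @doubling_state R m n) :
  strict_contraction s -> cmx_norm (dblF s) <= 1.
Proof.
move=> hs; apply/cmx_norm_leP => // i j.
have [|| _ /ltW h] := hs 0 (delta_mx j 0) 1 ltr01.
- by apply/cmx_norm_leP => // k l; rewrite mxE Normc.normc0.
- apply/cmx_norm_leP => // k l; rewrite mxE; case: (_ && _).
    by rewrite (Normc.normc1 R).
  by rewrite Normc.normc0.
move: h; rewrite mulmx0 add0r -colE => /(cmx_norm_leP _ ler01)/(_ i 0).
by rewrite mxE.
Qed.

(** The doubled state is the cascade of two copies of the network, that is,
    Redheffer's star product.  Between the copies run the waves
    [u = E a + G w] and [w = H u + F b].  If the larger of the two exceeded
    the size [c] of the data, it would be strictly smaller than itself.  So both
    are at most [c], hence strictly below [c], and so is the output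
    [E u + G b]. *)
Lemma strict_contraction_step_left m n (s : @doubling_state R m n)
    (a : 'cV[R[i]]_n) (b : 'cV[R[i]]_m) (c : R) :
  strict_contraction s -> 0 < c -> cmx_norm a <= c -> cmx_norm b <= c ->
  cmx_norm (dblE (doubling_step s) *m a + dblG (doubling_step s) *m b) < c.
Proof.
move=> hs c0 ac bc; have uGH := strict_contraction_unit hs.
case: s hs uGH => E F G H hs /= uGH; set IGH := invmx _.
pose u := IGH *m (E *m a + G *m (F *m b)).
pose w := H *m u + F *m b.
have uE : u = E *m a + G *m w.
  rewrite /w mulmxDr addrCA -{1}[u]mul1mx.
  have -> : E *m a + G *m (F *m b) = (1%:M - G *m H) *m u by rewrite mulKVmx.
  by rewrite mulmxBl mulmxA addrC subrK.
have bound (x z : 'cV[R[i]]_n) (y : 'cV[R[i]]_m) (d : R) :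
    0 < d -> cmx_norm x <= d -> cmx_norm y <= d ->
    z = E *m x + G *m y -> cmx_norm z < d.
  by move=> d0 xd yd ->; have [] := hs x y d d0 xd yd.
have -> : (E *m IGH *m E) *m a + (G + E *m IGH *m G *m F) *m b =
    E *m u + G *m b.
  by rewrite /u !mulmxDl !mulmxDr !mulmxA addrCA addrC -addrA.
suff [uc _] : cmx_norm u < c /\ cmx_norm w < c.
  exact: (bound u _ b c c0 (ltW uc) bc).
pose d := Num.max c (Num.max (cmx_norm u) (cmx_norm w)).
have cd : c <= d by rewrite le_max lexx.
have ud : cmx_norm u <= d by rewrite !le_max lexx orbT.
have wd : cmx_norm w <= d by rewrite !le_max lexx !orbT.
have d0 : 0 < d := lt_le_trans c0 cd.
have u_lt := bound a u w d d0 (le_trans ac cd) wd uE.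
have [_ w_lt] := hs u b d d0 ud (le_trans bc cd).
suff dc : d = c by rewrite dc in u_lt w_lt.
apply/le_anti; rewrite cd andbT leNgt; apply/negP => c_lt.
by have := ltxx d; rewrite {1}/d !gt_max c_lt u_lt w_lt.
Qed.

Lemma strict_contraction_step m n (s : @doubling_state R m n) :
  strict_contraction s -> strict_contraction (doubling_step s).
Proof.
move=> hs a b c c0 ac bc; split; first exact: strict_contraction_step_left.
have := strict_contraction_step_left (swap_strict_contraction hs) c0 bc ac.
by rewrite -swap_doubling_step addrC.
Qed.

(** The fixed-point form of an invariant subspace: for the initial state [X] is
    the extremal solution and [S] the Cayley transform of its closed-loop
    matrix.  The second equation measures how far [H] is from [X]. *)
Definition transfers m n (s : @doubling_state R m n) (X : 'M[R[i]]_(m, n))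
    (S : 'M[R[i]]_n) : Prop :=
  S = dblE s + dblG s *m X *m S /\ X = dblH s + dblF s *m X *m S.

Lemma transfers_step m n (s : @doubling_state R m n) X S :
  strict_contraction s -> transfers s X S ->
  transfers (doubling_step s) X (S *m S).
Proof.
move=> hs; have := strict_contraction_unit hs.
have := strict_contraction_unit (swap_strict_contraction hs).
case: s hs => E F G H hs; rewrite /transfers /= => /mulVmx HG /mulVmx GH [SE XE].
split; first exact: (transfer_factor_step SE XE GH).
exact: (transfer_limit_step SE XE HG).
Qed.

Lemma iter_strict_contraction m n (s : @doubling_state R m n) k :
  strict_contraction s -> strict_contraction (iter k (@doubling_step R m n) s).
Proof. by move=> hs; elim: k => //= k; exact: strict_contraction_step. Qed.

Lemma iter_transfers m n (s : @doubling_state R m n) X S k :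
  strict_contraction s -> transfers s X S ->
  transfers (iter k (@doubling_step R m n) s) X (S ^+ (2 ^ k)).
Proof.
move=> hs hX; elim: k => [|k IHk] //=.
rewrite expnS mul2n -addnn exprD; apply: transfers_step IHk.
exact: iter_strict_contraction.
Qed.

(** After [k] steps the error is [X - H = F X S ^ (2 ^ k)], where [F] stays
    bounded by contractivity and the power of [S] decays geometrically. *)
Lemma doubling_iterates_converge m n (s : @doubling_state R m n) X S :
  strict_contraction s -> transfers s X S ->
  (forall l, eigenvalue S l -> nrm l < 1) ->
  quadratically_converges (fun k => dblH (iter k (@doubling_step R m n) s)) X.
Proof.
move=> hs hX /contractive_powers[r r01 [c c0 hc]].
apply: (@geometric_quadratically_converges _ _ _ _ _
  (n%:R * (m%:R * cmx_norm X) * c) r _ r01).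
  by rewrite !mulr_ge0 ?cmx_norm_ge0 ?ler0n.
move=> k; have [_ XE] := iter_transfers k hs hX.
set F := dblF _ in XE; set H := dblH _ in XE *.
have -> : H - X = - (F *m X *m S ^+ (2 ^ k)).
  by rewrite {1}XE opprD addrA subrr add0r.
rewrite cmx_normN -mulrA.
apply: le_trans (cmx_normM _ _) _.
rewrite ler_pM ?mulr_ge0 ?cmx_norm_ge0 ?ler0n// ler_wpM2l ?ler0n//.
apply: le_trans (cmx_normM _ _) _.
rewrite ler_wpM2r ?cmx_norm_ge0// ler_piMr ?ler0n//.
exact/strict_contraction_F/iter_strict_contraction.
Qed.

End DoublingStep.

(** * The initial state as a Cayley transform *)

Section BlockInverse.
Context {K : comUnitRingType} (m n : nat).
Variables (A : 'M[K]_m) (B : 'M[K]_(m, n)) (C : 'M[K]_(n, m)) (D : 'M[K]_n).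
Local Notation W := (A - B *m invmx D *m C).
Local Notation V := (D - C *m invmx A *m B).
Hypotheses (uA : A \in unitmx) (uD : D \in unitmx).
Hypotheses (uW : W \in unitmx) (uV : V \in unitmx).

(* The Sherman-Morrison-Woodbury expression for the inverse of [V]. *)
Let Z := invmx D + invmx D *m C *m invmx W *m B *m invmx D.

Lemma schur_mulB : B *m Z = A *m (invmx W *m B *m invmx D).
Proof.
have W1 : A *m invmx W - B *m invmx D *m C *m invmx W = 1%:M.
  by rewrite -mulmxBl mulmxV.
rewrite /Z mulmxDr -[X in X + _](mul1mx (B *m invmx D)) -W1 mulmxBl !mulmxA.
by rewrite subrK.
Qed.

Lemma schur_woodbury : invmx V = Z.
Proof.
apply: (can_inj (mulKmx uV)); rewrite mulmxV// mulmxBl -!mulmxA schur_mulB.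
rewrite /Z mulmxDr !mulmxA mulmxV// mul1mx -!mulmxA mulKmx//.
by rewrite addrK.
Qed.

Lemma schur_block_inverse :
  block_mx D (- C) (- B) A *m
  block_mx (invmx V) (invmx D *m C *m invmx W)
           (invmx W *m B *m invmx D) (invmx W) = 1%:M.
Proof.
rewrite mulmx_block schur_woodbury// scalar_mx_block; congr block_mx.
- by rewrite /Z mulmxDr !mulmxA mulmxV// mul1mx !mulNmx addrK.
- by rewrite !mulmxA mulmxV// mul1mx mulNmx subrr.
- by rewrite mulNmx schur_mulB addNr.
- by rewrite mulNmx addrC !mulmxA -mulmxBl mulmxV.
Qed.

End BlockInverse.

Section MatrixEntries.
Context {K : pzRingType} (p q : nat).
Implicit Types M N : 'M[K]_(p, q).

Lemma mxD_entry M N i j : (M + N) i j = M i j + N i j. Proof. exact: mxE. Qed.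
Lemma mxN_entry M i j : (- M) i j = - M i j. Proof. exact: mxE. Qed.
Lemma mxZ_entry a M i j : (a *: M) i j = a * M i j. Proof. exact: mxE. Qed.

End MatrixEntries.

(* An additive identity between matrices is checked entrywise, every matrix
   product being treated as an indeterminate. *)
Ltac mx_linear :=
  apply/matrixP => ? ?; rewrite !(mxD_entry, mxN_entry, mxZ_entry); ring.

Section CayleyTransfer.
Context {K : comUnitRingType} (m n : nat).
Variables (A : 'M[K]_m) (B : 'M[K]_(m, n)) (C : 'M[K]_(n, m)) (D : 'M[K]_n).
Variables (E : 'M[K]_n) (F : 'M[K]_m) (G : 'M[K]_(n, m)) (H : 'M[K]_(m, n)).
Variables (al : K) (X : 'M[K]_(m, n)).
Hypothesis riccati : X *m C *m X - X *m D - A *m X + B = 0.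

Let S := D - C *m X.

(** The Riccati equation says that the columns of [(I, X)] span an invariant
    subspace of the block matrix with rows [(D, - C)] and [(B, - A)], on which
    it acts as [S]. *)
Lemma riccati_residual : B - A *m X = X *m S.
Proof.
rewrite /S mulmxBr mulmxA; apply/eqP; rewrite -subr_eq0 -riccati; apply/eqP.
mx_linear.
Qed.

(** This lemma and the next are the two block rows of
    [T (Q + al) (I, X) = (Q - al) (I, X)], where [T] has rows [(E, - G)] and
    [(- H, F)]: by the Riccati equation [Q] maps the columns of [(I, X)] to
    those of [(S, - X S)]. *)
Lemma cayley_factor : E *m (D + al%:M) + G *m B = D - al%:M ->
  E *m C + G *m (A + al%:M) = C ->
  E *m (S + al%:M) + G *m X *m (S - al%:M) = S - al%:M.
Proof.
move=> e1 e2; transitivity ((E *m (D + al%:M) + G *m B) -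
    (E *m C + G *m (A + al%:M)) *m X); last by rewrite e1 e2 /S addrAC.
rewrite [G *m X *m _]mulmxBr -(mulmxA G) -riccati_residual /S.
rewrite !(mulmxDl, mulmxDr, mulmxBr, mulmxBl) !mul_mx_scalar !mulmxN.
rewrite !(mulmxA, =^~ scalemxAl).
mx_linear.
Qed.

Lemma cayley_limit : H *m (D + al%:M) + F *m B = B ->
  H *m C + F *m (A + al%:M) = A - al%:M ->
  H *m (S + al%:M) + F *m X *m (S - al%:M) = X *m (S + al%:M).
Proof.
move=> e3 e4; transitivity ((H *m (D + al%:M) + F *m B) -
    (H *m C + F *m (A + al%:M)) *m X); last first.
  rewrite e3 e4 mulmxBl opprB addrCA addrC riccati_residual mul_scalar_mx.
  by rewrite -mul_mx_scalar -mulmxDr.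
rewrite [F *m X *m _]mulmxBr -(mulmxA F) -riccati_residual /S.
rewrite !(mulmxDl, mulmxDr, mulmxBr, mulmxBl) !mul_mx_scalar !mulmxN.
rewrite !(mulmxA, =^~ scalemxAl).
mx_linear.
Qed.

End CayleyTransfer.

(** * Spectrum of the Cayley transform *)
Section CayleySpectrum.
Context {R : realType}.
Variables (n : nat) (S : 'M[R[i]]_n) (al : R[i]).
Hypothesis S_spec : forall l, eigenvalue S l -> nrm (l - al) < nrm (l + al).

Lemma cayley_shift_unit : S + al%:M \in unitmx.
Proof.
rewrite unitmxE unitfE; apply/det0P => -[v v0].
rewrite mulmxDr mul_mx_scalar => /eqP; rewrite addr_eq0 -scaleNr => /eqP vS.
have /S_spec : eigenvalue S (- al) by apply/eigenvalueP; exists v.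
by rewrite addNr Normc.normc0 ltNge normc_ge0.
Qed.

(** An eigenvalue [mu] of the Cayley transform comes from the eigenvalue
    [l = al (1 + mu) / (1 - mu)] of [S], for which
    [l - al = mu (l + al)]. *)
Lemma cayley_eigenvalue mu : al != 0 ->
  eigenvalue ((S - al%:M) *m invmx (S + al%:M)) mu -> nrm mu < 1.
Proof.
move=> al0 /eigenvalueP[v vmu v0].
have vS : (1 - mu) *: (v *m S) = (al * (1 + mu)) *: v.
  have := congr1 (mulmx^~ (S + al%:M)) vmu.
  rewrite mulmxA mulmxKV ?cayley_shift_unit// -scalemxAl mulmxBr mulmxDr.
  rewrite !mul_mx_scalar scalerDr scalerA => /eqP; rewrite subr_eq => /eqP vS.
  by rewrite scalerBl scale1r {1}vS; mx_linear.
have mu1 : 1 - mu != 0.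
  apply/negP => /eqP mu1; move/eqP: vS; rewrite mu1 scale0r eq_sym scaler_eq0.
  have -> : mu = 1 by apply/eqP; rewrite eq_sym -subr_eq0 mu1.
  by rewrite mulf_eq0 (negbTE al0) (negbTE v0) -mulr2n pnatr_eq0.
pose l := al * (1 + mu) / (1 - mu).
have /S_spec : eigenvalue S l.
  apply/eigenvalueP; exists v => //.
  by rewrite /l mulrC -scalerA -vS scalerA mulVf// scale1r.
have -> : l - al = mu * (l + al) by rewrite /l; field.
rewrite Normc.normcM => h; have := normc_ge0 (l + al); nra.
Qed.

End CayleySpectrum.

(** * Contractivity from diagonal dominance *)
Section Dominance.
Context {R : realType}.

(** A condition on the rows of [Q] under which [Q + al] is invertible and the
    Cayley transform [(Q + al)^-1 (Q - al)] is a strict contraction for the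
    supremum norm. *)
Definition cayley_dominant p (Q : 'M[R[i]]_p) (al : R[i]) : Prop := forall i,
  nrm (Q i i - al) + offdiag_sum Q i < nrm (Q i i + al) - offdiag_sum Q i.

Lemma mulmx_row_split p (M : 'M[R[i]]_p) (v : 'cV[R[i]]_p) i :
  (M *m v) i 0 = M i i * v i 0 + \sum_(j | j != i) M i j * v j 0.
Proof. by rewrite mxE (bigD1 i). Qed.

Lemma offdiag_mul_le p (M : 'M[R[i]]_p) (v : 'cV[R[i]]_p) i c :
  (forall j, nrm (v j 0) <= c) ->
  nrm (\sum_(j | j != i) M i j * v j 0) <= offdiag_sum M i * c.
Proof.
move=> vc; apply: le_trans (ler_normc_sum _ _) _.
rewrite /offdiag_sum mulr_suml; apply: ler_sum => j _.
by rewrite Normc.normcM ler_wpM2l ?normc_ge0.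
Qed.

Lemma offdiag_sum_ge0 p (M : 'M[R[i]]_p) i : 0 <= offdiag_sum M i.
Proof. by apply: sumr_ge0 => j _; exact: normc_ge0. Qed.

Lemma offdiag_shift p (M : 'M[R[i]]_p) (v : 'cV[R[i]]_p) i a :
  ((M + a%:M) *m v) i 0 = (M i i + a) * v i 0 + \sum_(j | j != i) M i j * v j 0.
Proof.
by rewrite mulmxDl mul_scalar_mx mxE mulmx_row_split mxE mulrDl addrAC.
Qed.

(** Compare both sides in the row where [u] has its largest entry. *)
Lemma cayley_dominant_contraction p (Q : 'M[R[i]]_p) al (u v : 'cV[R[i]]_p) c :
  cayley_dominant Q al -> (Q + al%:M) *m u = (Q - al%:M) *m v ->
  0 < c -> cmx_norm v <= c -> cmx_norm u < c.
Proof.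
move=> dom uv c0 /(cmx_norm_leP _ (ltW c0)) vc; apply/cmx_norm_ltP => // i0 j.
rewrite ord1 {j}; have [i _ imax] :=
  @Order.TotalTheory.arg_maxP _ _ _ i0 xpredT (fun i => nrm (u i 0)) isT.
apply: le_lt_trans (imax i0 isT) _.
have := congr1 (fun w : 'cV_p => w i 0) uv; rewrite -raddfN !offdiag_shift.
move/(canRL (addrK _))/(congr1 (@nrm R)).
have := dom i; have := offdiag_mul_le Q i (fun j => imax j isT).
have := offdiag_mul_le Q i (vc^~ 0).
set su := \sum_(j | _) _ * u j 0; set sv := \sum_(j | _) _ * v j 0.
set q := offdiag_sum Q i; set M := nrm (u i 0) => hv hu di e.
have : nrm (Q i i + al) * M <= nrm (Q i i - al) * c + q * c + q * M.
  rewrite -Normc.normcM e; apply: le_trans (le_normcD _ _) _.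
  rewrite normcN lerD//; apply: le_trans (le_normcD _ _) _.
  by rewrite lerD// Normc.normcM ler_wpM2l ?normc_ge0.
have N0 := normc_ge0 (Q i i - al); have q0 : 0 <= q := offdiag_sum_ge0 _ _.
move: di; set P := nrm (Q i i + al); set N := nrm (Q i i - al) in N0 *.
move: P N N0 => P N N0 di le_M.
have Pq : 0 < P - q by lra.
rewrite -(ltr_pM2l Pq); apply: (@le_lt_trans _ _ ((N + q) * c));
  last by rewrite ltr_pM2r.
by rewrite mulrBl mulrDl lerBlDr.
Qed.

Lemma cayley_dominant_unit p (Q : 'M[R[i]]_p) al :
  cayley_dominant Q al -> Q + al%:M \in unitmx.
Proof.
move=> dom; apply: unitmx_of_ker => v Qv.
apply: cmx_norm_eq0; rewrite leNgt; apply/negP => v0.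
have : cmx_norm v < cmx_norm v.
  apply: (cayley_dominant_contraction (v := 0) dom) => //.
    by rewrite Qv mulmx0.
  by apply/cmx_norm_leP => [|i j]; rewrite ?(ltW v0)// mxE Normc.normc0 ltW.
by rewrite ltxx.
Qed.

Variables (m n : nat).
Implicit Types (A : 'M[R[i]]_m) (L : 'M[R[i]]_(m, n)) (U : 'M[R[i]]_(n, m)).
Implicit Types (D : 'M[R[i]]_n) (al : R[i]).

Lemma offdiag_sum_drblock A L U D i :
  offdiag_sum A i <= offdiag_sum (block_mx D U L A) (rshift n i).
Proof.
rewrite /offdiag_sum [leRHS]big_mkcond big_split_ord /= -[leLHS]add0r.
apply: lerD; first by apply: sumr_ge0 => j _; case: ifP; rewrite ?normc_ge0.
rewrite [leLHS]big_mkcond; apply: ler_sum => j _.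
by rewrite (inj_eq (@rshift_inj _ _)) block_mxEdr.
Qed.

Lemma offdiag_sum_ulblock A L U D i :
  offdiag_sum D i <= offdiag_sum (block_mx D U L A) (lshift m i).
Proof.
rewrite /offdiag_sum [leRHS]big_mkcond big_split_ord /= -[leLHS]addr0.
apply: lerD; last by apply: sumr_ge0 => j _; case: ifP; rewrite ?normc_ge0.
rewrite [leLHS]big_mkcond; apply: ler_sum => j _.
by rewrite (inj_eq (@lshift_inj _ _)) block_mxEul.
Qed.

Lemma cayley_dominant_drblock A L U D al :
  cayley_dominant (block_mx D U L A) al -> cayley_dominant A al.
Proof.
move=> dom i; have := dom (rshift n i); rewrite block_mxEdr.
by have := offdiag_sum_drblock A L U D i; lra.
Qed.

Lemma cayley_dominant_ulblock A L U D al :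
  cayley_dominant (block_mx D U L A) al -> cayley_dominant D al.
Proof.
move=> dom i; have := dom (lshift m i); rewrite block_mxEul.
by have := offdiag_sum_ulblock A L U D i; lra.
Qed.

End Dominance.

(** * The parameter condition *)
Section OmegaDisk.
Context {R : realType}.
Variables (om t : R).
Let al : R[i] := t%:C * (om +i* (1 - om)).
Let s : R := Num.sqrt (varpi om).

Lemma varpi_gt0 : 0 < varpi om.
Proof. by rewrite /varpi; nra. Qed.

Lemma sqrt_varpi_gt0 : 0 < s. Proof. by rewrite sqrtr_gt0 varpi_gt0. Qed.

(** [omega_re] and [omega_im] are the real and imaginary parts of
    [conj z * x] for [z = om + i (1 - om)], and [|z| ^ 2 = varpi om]. *)
Lemma normc_omega (x : R[i]) :
  s * nrm x = Num.sqrt (omega_re om x ^+ 2 + omega_im om x ^+ 2).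
Proof.
case: x => a b; rewrite /s -sqrtrM ?(ltW varpi_gt0)//; congr Num.sqrt.
by rewrite /varpi /omega_re /omega_im /=; ring.
Qed.

Lemma omega_shiftD (x : R[i]) :
  (omega_re om (x + al) = omega_re om x + t * varpi om) *
  (omega_im om (x + al) = omega_im om x).
Proof.
by rewrite /al; case: x => a b; rewrite /omega_re /omega_im /varpi /=; split; ring.
Qed.

Lemma omega_shiftB (x : R[i]) :
  (omega_re om (x - al) = omega_re om x - t * varpi om) *
  (omega_im om (x - al) = omega_im om x).
Proof.
by rewrite /al; case: x => a b; rewrite /omega_re /omega_im /varpi /=; split; ring.
Qed.

(** The half-plane [0 < omega_re om x] is the set of points closer to [al]
    than to [- al], since [al] is a positive multiple of its inner normal. *)
Lemma halfplane_closer (x : R[i]) : 0 < t -> 0 < omega_re om x ->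
  nrm (x - al) < nrm (x + al).
Proof.
move=> t0 x0; rewrite -(ltr_pM2l sqrt_varpi_gt0) !normc_omega.
have := mulr_gt0 t0 varpi_gt0.
rewrite !omega_shiftD !omega_shiftB => ?; rewrite ltr_sqrt; nra.
Qed.

(** Write [T = t varpi].  Clearing denominators, the condition on [t] reads
    [s |x - al| <= T - q], whereas [q < omega_re om x] gives
    [T + q < s |x + al|].  As [s <= 1], the two combine to the dominance
    inequality multiplied by [s]. *)
Lemma omega_disk_dominance (x : R[i]) (q : R) : 0 <= om <= 1 ->
  0 <= q < omega_re om x ->
  (omega_re om x + q) / 2 + omega_im om x ^+ 2 / (2 * (omega_re om x - q)) <=
    t * varpi om ->
  nrm (x - al) + q < nrm (x + al) - q.
Proof.
move=> /andP[om0 om1] /andP[q0 qx] ht.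
have s0 := sqrt_varpi_gt0.
have s1 : s <= 1.
  by rewrite -(sqrtr1 R) ler_sqrt// /varpi; nra.
have hN : s * nrm (x - al) <= t * varpi om - q.
  rewrite normc_omega !omega_shiftB; move: ht.
  set r := omega_re om x in qx *; set w := omega_im om x.
  set T := t * varpi om => ht.
  have rq : 0 < r - q by lra.
  have w2 : w ^+ 2 / (2 * (r - q)) * (2 * (r - q)) = w ^+ 2.
    by rewrite divfK// gt_eqF//; lra.
  have w0 : 0 <= w ^+ 2 / (2 * (r - q)).
    by rewrite divr_ge0 ?sqr_ge0//; lra.
  rewrite -[leRHS]ger0_norm; last by lra.
  rewrite -sqrtr_sqr ler_sqrt ?sqr_ge0//.
  move: w2 w0 ht; set y := _ / _ => <- y0 ht; nra.
have hP : t * varpi om + q < s * nrm (x + al).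
  rewrite normc_omega !omega_shiftD.
  have T0 : 0 <= t * varpi om.
    apply: le_trans ht; rewrite addr_ge0 ?divr_ge0 ?sqr_ge0//; lra.
  rewrite -[ltLHS]ger0_norm; last by lra.
  rewrite -sqrtr_sqr ltr_sqrt; have := sqr_ge0 (omega_im om x); nra.
rewrite -(ltr_pM2l s0) mulrDr mulrBr; nra.
Qed.

End OmegaDisk.

(** * Contractivity and convergence of the algorithm *)

Section CayleyEquations.
Context {R : realType}.

(** For the matrix [Q] of coefficients and [T] the block matrix with rows
    [(E, - G)] and [(- H, F)], these are the four blocks of
    [T (Q + al) = Q - al]. *)
Definition cayley_equations m n (A : 'M[R[i]]_m) (B : 'M[R[i]]_(m, n))
    (C : 'M[R[i]]_(n, m)) (D : 'M[R[i]]_n) (al : R[i])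
    (s : @doubling_state R m n) : Prop :=
  [/\ dblE s *m (D + al%:M) + dblG s *m B = D - al%:M,
      dblE s *m C + dblG s *m (A + al%:M) = C,
      dblH s *m (D + al%:M) + dblF s *m B = B &
      dblH s *m C + dblF s *m (A + al%:M) = A - al%:M].

Lemma swap_cayley_equations m n (A : 'M[R[i]]_m) (B : 'M[R[i]]_(m, n))
    (C : 'M[R[i]]_(n, m)) (D : 'M[R[i]]_n) al (s : @doubling_state R m n) :
  cayley_equations A B C D al s -> cayley_equations D C B A al (swap_state s).
Proof. by move=> [e1 e2 e3 e4]; split; rewrite addrC. Qed.

End CayleyEquations.

Section Initialization.
Context {R : realType}.
Variables (m n : nat).
Variables (A : 'M[R[i]]_m) (B : 'M[R[i]]_(m, n)).
Variables (C : 'M[R[i]]_(n, m)) (D : 'M[R[i]]_n).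
Variable al : R[i].
Hypothesis dom : cayley_dominant (are_coef A B C D) al.

Local Notation P := (are_coef A B C D + al%:M).
Local Notation N := (are_coef A B C D - al%:M).
Local Notation s := (doubling_init A B C D al al).
Let T := block_mx (dblE s) (- dblG s) (- dblH s) (dblF s).

Lemma are_coef_shift : P = block_mx (shiftD D al) (- C) (- B) (shiftA A al).
Proof. by rewrite /are_coef scalar_mx_block add_block_mx !addr0. Qed.

Lemma shiftA_unit : shiftA A al \in unitmx.
Proof. exact/cayley_dominant_unit/(cayley_dominant_drblock dom). Qed.

Lemma shiftD_unit : shiftD D al \in unitmx.
Proof. exact/cayley_dominant_unit/(cayley_dominant_ulblock dom). Qed.

(** The Schur complements [matW] and [matV] are invertible because a kernel
    vector extends to a kernel vector of the whole shifted matrix. *)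
Lemma are_coef_shift_inj x y :
  shiftD D al *m x = C *m y -> shiftA A al *m y = B *m x ->
  x = 0 :> 'cV[R[i]]_n /\ y = 0 :> 'cV[R[i]]_m.
Proof.
move=> Dx Ay; have : P *m col_mx x y = 0.
  by rewrite are_coef_shift mul_block_col !mulNmx Dx Ay subrr addNr col_mx0.
move/(congr1 (mulmx (invmx P))).
rewrite mulKmx ?cayley_dominant_unit// mulmx0 -col_mx0.
exact: eq_col_mx.
Qed.

Lemma matW_unit : matW A B C D al al \in unitmx.
Proof.
apply: unitmx_of_ker => y /eqP; rewrite mulmxBl subr_eq0 => /eqP Wy.
have [] := @are_coef_shift_inj (invmx (shiftD D al) *m C *m y) y => //.
  by rewrite -mulmxA mulKVmx ?shiftD_unit.
by rewrite Wy !mulmxA.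
Qed.

Lemma matV_unit : matV A B C D al al \in unitmx.
Proof.
apply: unitmx_of_ker => x /eqP; rewrite mulmxBl subr_eq0 => /eqP Vx.
have [] := @are_coef_shift_inj x (invmx (shiftA A al) *m B *m x) => //.
  by rewrite Vx !mulmxA.
by rewrite -mulmxA mulKVmx ?shiftA_unit.
Qed.

(** By the block inversion formula the four initial matrices assemble into
    [1 - 2 al (Q + al)^-1], which is the Cayley transform
    [(Q + al)^-1 (Q - al)]. *)
Lemma cayley_block_inverse : T = 1%:M - (al + al) *: invmx P.
Proof.
have PZ := schur_block_inverse shiftA_unit shiftD_unit matW_unit matV_unit.
rewrite are_coef_shift; set Z := block_mx (invmx _) _ _ _ in PZ.
have [uP _] := mulmx1_unit PZ.
have -> : invmx (block_mx (shiftD D al) (- C) (- B) (shiftA A al)) = Z.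
  by rewrite -[LHS]mulmx1 -PZ mulKmx.
by rewrite /Z scale_block_mx opp_block_mx scalar_mx_block add_block_mx !add0r.
Qed.

Lemma are_coef_shiftB : N = P - (al + al)%:M.
Proof. by rewrite raddfD opprD addrA addrK. Qed.

Lemma cayley_block_mull : P *m T = N.
Proof.
rewrite cayley_block_inverse mulmxBr mulmx1 -scalemxAr.
rewrite mulmxV ?cayley_dominant_unit//.
by rewrite scalemx1 are_coef_shiftB.
Qed.

Lemma cayley_block_mulr : T *m P = N.
Proof.
rewrite cayley_block_inverse mulmxBl mul1mx -scalemxAl.
rewrite mulVmx ?cayley_dominant_unit//.
by rewrite scalemx1 are_coef_shiftB.
Qed.

Lemma doubling_init_contraction : strict_contraction s.
Proof.
move=> a b c c0 ac bc.
(* The signs of [- b] and of the second component of [u] compensate those of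
   the off-diagonal blocks of [T]. *)
pose v := col_mx a (- b).
pose u := col_mx (dblE s *m a + dblG s *m b) (- (dblH s *m a + dblF s *m b)).
have uE : u = T *m v.
  by rewrite /u mul_block_col !mulNmx !mulmxN opprK opprD.
have : cmx_norm u < c.
  apply: (cayley_dominant_contraction dom (v := v)) => //.
    by rewrite uE mulmxA cayley_block_mull.
  apply/cmx_norm_leP => [|r j]; first exact: ltW.
  rewrite -[r]splitK; case: (fintype.split r) => k /=.
    by rewrite col_mxEu (le_trans (normc_le_cmx _ _ _)).
  by rewrite col_mxEd (le_trans (normc_le_cmx _ _ _))// cmx_normN.
move/(cmx_norm_ltP _ c0) => uc; split; apply/cmx_norm_ltP => // i j.
  by have := uc (lshift m i) j; rewrite col_mxEu.
by have := uc (rshift n i) j; rewrite col_mxEd mxE normcN.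
Qed.

Lemma doubling_init_equations : cayley_equations A B C D al s.
Proof.
have := cayley_block_mulr; rewrite {1}are_coef_shift mulmx_block.
rewrite /are_coef scalar_mx_block opp_block_mx add_block_mx !oppr0 !addr0.
move=> /eq_block_mx[]; rewrite !(mulmxN, mulNmx, opprK) => e1 e2 e3 e4.
split=> //; apply: oppr_inj.
  by rewrite -e2 opprD.
by rewrite -e3 opprD.
Qed.

End Initialization.

Section Transfer.
Context {R : realType}.

Lemma cayley_transfers m n (A : 'M[R[i]]_m) (B : 'M[R[i]]_(m, n))
    (C : 'M[R[i]]_(n, m)) (D : 'M[R[i]]_n) al X (s : @doubling_state R m n) :
  cayley_equations A B C D al s -> are_solution A B C D X ->
  D - C *m X + al%:M \in unitmx ->
  transfers s X ((D - C *m X - al%:M) *m invmx (D - C *m X + al%:M)).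
Proof.
move=> [e1 e2 e3 e4] sol uS; split; apply: (can_inj (mulmxK uS)).
  by rewrite /= [RHS]mulmxDl !mulmxA !mulmxKV// (cayley_factor sol e1 e2).
by rewrite /= [RHS]mulmxDl !mulmxA !mulmxKV// (cayley_limit sol e3 e4).
Qed.

Lemma extremal_doubling_converges m n om t (A : 'M[R[i]]_m)
    (B : 'M[R[i]]_(m, n)) (C : 'M[R[i]]_(n, m)) (D : 'M[R[i]]_n) X
    (s : @doubling_state R m n) :
  let al := t%:C * (om +i* (1 - om)) in
  0 < t -> strict_contraction s -> cayley_equations A B C D al s ->
  extremal_solution om A B C D X ->
  quadratically_converges (fun k => dblH (iter k (@doubling_step R m n) s)) X.
Proof.
move=> al t0 hs eqs [sol spec].
have hspec l : eigenvalue (D - C *m X) l -> nrm (l - al) < nrm (l + al).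
  by move=> /spec; exact: halfplane_closer.
have uS := cayley_shift_unit hspec.
apply: (doubling_iterates_converge hs (cayley_transfers eqs sol uS)).
move=> l; apply: cayley_eigenvalue => //.
apply/eqP => al0; have [+ _] := omega_shiftD om t 0.
rewrite -/al al0 addr0 /omega_re /= !mulr0 addr0 add0r => /esym/eqP.
by rewrite mulf_eq0 !gt_eqF ?varpi_gt0.
Qed.

End Transfer.

Lemma le_max_ord (R : realType) N (f : 'I_N -> R) i : f i <= max_ord f.
Proof.
apply: ub_le_sup; last by exists i.
exists (\big[Num.max/f i]_j f j) => _ [j _ <-]; exact: le_bigmax.
Qed.

Lemma omega_cmp_row_sum (R : realType) N om (Q : 'M[R[i]]_N) i :
  (omega_cmp om Q *m const_mx 1 : 'cV_N) i 0 = omega_re om (Q i i) - offdiag_sum Q i.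
Proof.
rewrite mxE (bigD1 i)//= !mxE eqxx mulr1 /offdiag_sum -sumrN; congr (_ + _).
by apply: eq_bigr => j ji; rewrite !mxE mulr1 eq_sym (negbTE ji).
Qed.

Lemma p_omega_gt0 (R : realType) N om (Q : 'M[R[i]]_N) i :
  offdiag_sum Q i < omega_re om (Q i i) -> 0 < p_omega om Q i.
Proof.
move=> qr; have q0 := offdiag_sum_ge0 Q i.
apply: ltr_wpDr; last by lra.
by rewrite divr_ge0 ?sqr_ge0//; lra.
Qed.

Theorem theorem6p5 (R : realType) (m n : nat) (m_gt0 : (0 < m)%N)
    (n_gt0 : (0 < n)%N) (omega : R) (omega01 : 0 <= omega <= 1)
    (A : 'M[R[i]]_m) (B : 'M[R[i]]_(m, n))
    (C : 'M[R[i]]_(n, m)) (D : 'M[R[i]]_n)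
    (ABCD_H : class_H omega A B C D)
    (Q1_pos : pos_col (omega_cmp omega (are_coef A B C D) *m const_mx 1))
    (Phi : 'M[R[i]]_(m, n)) (Psi : 'M[R[i]]_(n, m))
    (Phi_ext : extremal_solution omega A B C D Phi)
    (Psi_ext : extremal_solution omega D C B A Psi)
    (t : R) :
  let Q := are_coef A B C D in
  let psi1 := max_ord (fun i : 'I_m => p_omega omega Q (rshift n i) / varpi omega) in
  let psi2 := max_ord (fun i : 'I_n => p_omega omega Q (lshift m i) / varpi omega) in
  let alpha := t%:C * (omega +i* (1 - omega)) in
  Num.max psi1 psi2 <= t ->
  [/\ SDA_well_defined A B C D alpha,
      quadratically_converges (fun k => dblH (SDA A B C D alpha k)) Phi
    & quadratically_converges (fun k => dblG (SDA A B C D alpha k)) Psi].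
Proof.
move=> Q psi1 psi2 alpha tmax.
have rowQ i : offdiag_sum Q i < omega_re omega (Q i i).
  by rewrite -subr_gt0 -omega_cmp_row_sum; exact: Q1_pos.
have pt r : p_omega omega Q r / varpi omega <= t.
  apply: le_trans tmax; rewrite le_max -[r]splitK.
  case: (fintype.split r) => k /=; apply/orP; [right|left].
    exact: (@le_max_ord _ _ (fun i => p_omega omega Q (lshift m i) / _)).
  exact: (@le_max_ord _ _ (fun i => p_omega omega Q (rshift n i) / _)).
have t0 : 0 < t.
  apply: lt_le_trans (pt (lshift m (Ordinal n_gt0))).
  by rewrite divr_gt0 ?varpi_gt0 ?p_omega_gt0.
have dom : cayley_dominant Q alpha.
  move=> i; apply: omega_disk_dominance => //.
    by rewrite offdiag_sum_ge0 rowQ.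
  by rewrite -ler_pdivrMr ?varpi_gt0//; exact: pt.
have hs := doubling_init_contraction dom.
have eqs := doubling_init_equations dom.
split.
- split; [exact: shiftA_unit dom|exact: shiftD_unit dom|exact: matW_unit dom|
    exact: matV_unit dom|move=> k /=].
  have hk := iter_strict_contraction k hs.
  split; first exact: strict_contraction_unit.
  exact: strict_contraction_unit (swap_strict_contraction hk).
- exact: (extremal_doubling_converges t0 hs eqs Phi_ext).
- have -> : (fun k => dblG (SDA A B C D alpha k)) = (fun k =>
      dblH (iter k (@doubling_step R n m)
        (swap_state (doubling_init A B C D alpha alpha)))).
    apply/funext => k; rewrite -[LHS]/(dblH (swap_state _)); congr dblH.
    by rewrite /SDA /doubling; elim: k => //= k <-; rewrite swap_doubling_step.
  exact: (extremal_doubling_converges t0 (swap_strict_contraction hs)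
    (swap_cayley_equations eqs) Psi_ext).
Qed.
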